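(* Let $Q$ be a real symmetric $n\times n$ matrix and $c\in\mathbf{R}^n$. Let $X\subset\mathbf{R}^n$ be a (nonempty) polytope, and let $\{x\in\mathbf{R}^n:\bar Ax\le\bar b\}$ and $\{x\in\mathbf{R}^n:\hat Ax\le\hat b\}$ be two different representations of $X$ by finitely many linear inequalities, with $\bar A\in\mathbf{R}^{\bar m\times n}$ and $\hat A\in\mathbf{R}^{\hat m\times n}$. Then the optimal values of problem (L) (for the objective data $Q,c$) corresponding to these two representations are equal.
   Context: For a polytope $X=\{x\in\mathbf{R}^n:Ax\le b\}$ with $A\in\mathbf{R}^{m\times n}$ (rows $A_i$) and $b\in\mathbf{R}^m$, problem (L) corresponding to this representation is $$\begin{array}{ll}\max & \ell\\ \text{s.t.} & x^TQx+2c^Tx-\ell+\sum_{i=1}^m\alpha_i(x)(A_ix-b_i)\in P[x],\\ & \alpha_i\in\mathcal{A}_+(X),\ i=1,\dots,m,\end{array}$$ with variables $\ell\in\mathbf{R}$ and affine functions $\alpha_i$. Here $P[x]$ is the set of polynomials nonnegative on $\mathbf{R}^n$, and $\mathcal{A}_+(X)$ is the set of affine functions $\mathbf{R}^n\to\mathbf{R}$ that are nonnegative on $X$. Polytopes are bounded and nonempty throughout. *)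

(* Defs.v *)
From mathcomp Require Import all_boot all_order all_algebra.
From mathcomp Require Import boolp classical_sets reals ereal normedtype.
(* mpoly is not Imported: its notations clash with those of the analysis
   libraries. *)
From mathcomp Require mpoly.

Set Implicit Arguments.
Unset Strict Implicit.
Unset Printing Implicit Defensive.

Import Order.TTheory GRing.Theory Num.Theory.
Import numFieldNormedType.Exports.

Local Open Scope classical_set_scope.
Local Open Scope ring_scope.

Definition polyhedron (R : realType) (m n : nat) (A : 'M[R]_(m, n))
    (b : 'cV[R]_m) : set 'cV[R]_n :=
  [set x | forall i, (A *m x) i 0 <= b i 0].

Definition polytope (R : realType) (n : nat) (X : set 'cV[R]_n) : Prop :=
  [/\ X !=set0, bounded_set X &
      exists (m : nat) (A : 'M[R]_(m, n)) (b : 'cV[R]_m), X = polyhedron A b].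

Definition affine_fun (R : realType) (n : nat) (f : 'cV[R]_n -> R) : Prop :=
  exists (a : 'rV[R]_n) (d : R), forall x, f x = (a *m x) 0 0 + d.

Definition affine_nonneg (R : realType) (n : nat) (X : set 'cV[R]_n) :
    set ('cV[R]_n -> R) :=
  [set f | affine_fun f /\ forall x, X x -> 0 <= f x].

(* Polynomials over the infinite field R are identified with the functions on
   R^n that they induce. *)
Definition polynomial_fun (R : realType) (n : nat) (f : 'cV[R]_n -> R) : Prop :=
  exists p : mpoly.mpoly n R,
    forall x : 'cV[R]_n, f x = mpoly.meval (fun j => x j 0) p.

Definition poly_nonneg (R : realType) (n : nat) : set ('cV[R]_n -> R) :=
  [set f | polynomial_fun f /\ forall x, 0 <= f x].

Arguments poly_nonneg : clear implicits.

Section ProblemL.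
Variables (R : realType) (m n : nat).
Variables (Q : 'M[R]_n) (c : 'cV[R]_n) (A : 'M[R]_(m, n)) (b : 'cV[R]_m).

Definition L_feasible (l : R) (alpha : 'I_m -> 'cV[R]_n -> R) : Prop :=
  poly_nonneg R n (fun x =>
      (x^T *m Q *m x) 0 0 + 2 * (c^T *m x) 0 0 - l
      + \sum_(i < m) alpha i x * ((A *m x) i 0 - b i 0))
  /\ forall i, affine_nonneg (polyhedron A b) (alpha i).

(* The supremum is taken in the extended reals: it is -oo if the problem is
   infeasible, and attainment is not presupposed. *)
Definition L_value : \bar R :=
  ereal_sup [set l%:E | l in [set l | exists alpha, L_feasible l alpha]].

End ProblemL.

(* Main.v *)
(** By Farkas' lemma, each slack [bbar_i - Abar_i x] is a nonnegative combination of the slacks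
    [bhat_j - Ahat_j x] plus a constant [e_i >= 0].  Substituting this in the
    aggregated constraint turns the multipliers [alpha_i] into
    [\sum_i U_ij alpha_i] and leaves the affine function [- \sum_i e_i alpha_i],
    which is nonpositive on [X] but not on the whole space.  Applying Farkas'
    lemma to [\sum_i e_i alpha_i] itself absorbs it in the new multipliers, up
    to a nonnegative constant, which can be added to a nonnegative polynomial.
    Hence both problems have the same feasible values [l]. *)
Require Import Defs.
From mathcomp Require Import all_boot all_order all_algebra.
From mathcomp Require Import boolp classical_sets reals ereal normedtype.
From mathcomp Require Import ring lra.
From mathcomp Require Import(canonicals) mpoly.

Import Order.TTheory GRing.Theory Num.Theory.

Local Open Scope ring_scope.

(* Induction on the number of rows (Bartl): if the first row [a] cannot be
   dropped, a witness [y] of this has [a y > 0], and projecting along [y] onto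
   the kernel of [a] removes that row. *)
Lemma farkas (F : realFieldType) (m n : nat) (A : 'M[F]_(m, n)) (g : 'rV[F]_n) :
  (forall x : 'cV_n, (forall i, (A *m x) i 0 <= 0) -> (g *m x) 0 0 <= 0) ->
  exists2 u : 'rV_m, forall i, 0 <= u 0 i & g = u *m A.
Proof.
elim: m A g => [|m IHm] A g hg.
  exists 0 => [i|]; first by rewrite mxE.
  have g0 (x : 'cV_n) : (g *m x) 0 0 <= 0 by apply: hg; case.
  rewrite mul0mx; apply/rowP=> j; rewrite mxE; apply/eqP.
  have gE s : (g *m (s *: delta_mx j 0 : 'cV_n)) 0 0 = s * g 0 j.
    by rewrite -scalemxAr -colE !mxE.
  have := g0 (1 *: delta_mx j 0); have := g0 (- 1 *: delta_mx j 0).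
  by rewrite !gE; lra.
move: A hg; rewrite -[m.+1]/(1 + m)%N => A.
rewrite -[A]vsubmxK; set a := usubmx A; set B := dsubmx A => hg.
have {}hg (x : 'cV_n) : (a *m x) 0 0 <= 0 -> (forall i, (B *m x) i 0 <= 0) ->
    (g *m x) 0 0 <= 0.
  move=> ha hB; apply: hg => i; rewrite mul_col_mx -(splitK i).
  by case: (split i) => k; rewrite /= ?col_mxEu ?col_mxEd // ord1.
have [hB|/existsNP[y /not_implyP[By /negP]]] := pselect (forall x : 'cV_n,
    (forall i, (B *m x) i 0 <= 0) -> (g *m x) 0 0 <= 0).
  have [u u0 ->] := IHm B g hB.
  exists (row_mx 0 u) => [i|]; last by rewrite mul_row_col mul0mx add0r.
  by rewrite -(splitK i); case: (split i) => k; rewrite /= ?row_mxEl ?row_mxEr ?mxE.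
rewrite -ltNge => gy.
have ay : 0 < (a *m y) 0 0.
  by rewrite ltNge; apply/negP => ay; have := hg y ay By; rewrite leNgt gy.
(* Scaling [y] by a positive factor keeps its signs and makes [x - y (a x)] the projection onto the
   kernel of [a]. *)
wlog ay1 : y By gy ay / (a *m y) 0 0 = 1.
  move=> /(_ (((a *m y) 0 0)^-1 *: y)); apply.
  - move=> i; rewrite -scalemxAr mxE; apply: mulr_ge0_le0 => //.
    by rewrite invr_ge0 ltW.
  - by rewrite -scalemxAr mxE mulr_gt0 ?invr_gt0.
  - by rewrite -scalemxAr mxE mulVf ?gt_eqF.
  - by rewrite -scalemxAr mxE mulVf ?gt_eqF.
have ay1M : a *m y = 1%:M by rewrite [LHS]mx11_scalar ay1.
(* Since [a] vanishes on projected vectors, only the rows of [B] remain as constraints there. *)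
have [x hx|u u0 gE] := IHm (B - B *m y *m a) (g - g *m y *m a).
  rewrite mulmxBl -!mulmxA -mulmxBr; apply: hg => [|i].
    by rewrite mulmxBr mulmxA ay1M mul1mx subrr mxE.
  by have := hx i; rewrite mulmxBl -!mulmxA -mulmxBr.
(* Expanding [g - g y a = u (B - B y a)] gives the coefficient of [a]; it is nonnegative because
   [g y > 0], [u >= 0] and [B y <= 0]. *)
exists (row_mx (g *m y - u *m B *m y) u).
  move=> i; rewrite -(splitK i); case: (split i) => k; rewrite /= ?row_mxEl ?row_mxEr //.
  rewrite ord1 mxE [X in _ + X]mxE subr_ge0 (le_trans _ (ltW gy))// -mulmxA mxE.
  by apply: sumr_le0 => j _; apply: mulr_ge0_le0.
rewrite mul_row_col mulmxBl -[LHS](subrK (g *m y *m a)) gE mulmxBr !mulmxA.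
by rewrite addrC addrA addrAC.
Qed.

(** Homogenization: [farkas] is applied to the cone of pairs [(x, t)] with [A x <= t b] and
    [t >= 0], and to the functional [- (a x + d t)]. The multiplier of the row [- t <= 0] becomes
    [e]. Nonemptiness settles the case [t = 0]. *)
Lemma affine_farkas (R : realType) (m n : nat) (A : 'M[R]_(m, n)) (b : 'cV[R]_m)
    (a : 'rV[R]_n) (d : R) :
  (polyhedron A b !=set0)%classic ->
  (forall x, polyhedron A b x -> 0 <= (a *m x) 0 0 + d) ->
  exists u : 'rV[R]_m, exists e : R,
    [/\ forall i, 0 <= u 0 i, 0 <= e, a = - (u *m A) & d = (u *m b) 0 0 + e].
Proof.
move=> [x0 Xx0] had.
have [z hz|v v0] := @farkas R _ _ (block_mx A (- b) 0 (- 1%:M)) (- row_mx a d%:M).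
  rewrite -[z]vsubmxK in hz *; set x := usubmx z in hz *.
  set t := (dsubmx z) 0 0.
  have tE : dsubmx z = t%:M by rewrite [LHS]mx11_scalar.
  rewrite tE in hz *.
  have Axt i : (A *m x) i 0 <= t * b i 0.
    have := hz (lshift 1 i); rewrite mul_block_col col_mxEu mxE.
    by rewrite mul_mx_scalar !mxE; lra.
  have t0 : 0 <= t.
    have := hz (rshift m ord0); rewrite mul_block_col col_mxEd mul0mx add0r.
    by rewrite mul_mx_scalar !mxE eqxx mulr1n; lra.
  rewrite mulNmx mxE mul_row_col mul_scalar_mx !mxE eqxx mulr1n oppr_le0.
  rewrite -[\sum_j _](_ : (a *m x) 0 0 = _); last by rewrite mxE.
  have [tp|t0'] := ltP 0 t.
    have : polyhedron A b (t^-1 *: x).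
      by move=> i; rewrite -scalemxAr mxE ler_pdivrMl.
    move=> /had; rewrite -scalemxAr mxE => h.
    have := mulr_ge0 t0 h; rewrite mulrDr mulVKf ?gt_eqF// => h'.
    by rewrite mulrC.
  have {t0 t0'} tz : t = 0 by apply/le_anti/andP.
  rewrite tz mulr0 addr0 leNgt; apply/negP => ax.
  (* [x] is a recession direction, along which [a] would be unbounded below *)
  pose s := ((a *m x0) 0 0 + d + 1) / - (a *m x) 0 0.
  have s0 : 0 <= s.
    by rewrite divr_ge0 ?oppr_ge0 ?(ltW ax)// addr_ge0 ?had.
  have xsE k (M : 'M_(k, n)) i :
      (M *m (x0 + s *: x)) i 0 = (M *m x0) i 0 + s * (M *m x) i 0.
    by rewrite mulmxDr -scalemxAr mxE [X in _ + X]mxE.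
  have : polyhedron A b (x0 + s *: x).
    move=> i; rewrite xsE.
    have := Axt i; rewrite tz mul0r => Ax.
    by have := Xx0 i; have := mulr_ge0_le0 s0 Ax; lra.
  move=> /had; rewrite xsE.
  (* By the choice of [s], the affine function equals -1 at [x0 + s x], a point of the
     polyhedron. *)
  have -> : s * (a *m x) 0 0 = - ((a *m x0) 0 0 + d + 1).
    by rewrite /s invrN mulrN mulNr mulfVK ?lt_eqF.
  by lra.
rewrite -[v]hsubmxK mul_row_block mulmx0 addr0 opp_row_mx => /eq_row_mx[aE dE].
exists (lsubmx v), ((rsubmx v) 0 0); split.
- by move=> i; rewrite mxE.
- by rewrite mxE.
- by rewrite -aE opprK.
- move: dE; rewrite !mulmxN mulmx1 -opprD => /oppr_inj.
  by move=> /(congr1 (fun M : 'M_1 => M 0 0)); rewrite mxE eqxx mulr1n [RHS]mxE.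
Qed.

Lemma poly_nonnegD_cst {R : realType} {n : nat} {f g : 'cV[R]_n -> R} {e : R} :
  0 <= e -> (forall x, g x = f x + e) ->
  poly_nonneg R n f -> poly_nonneg R n g.
Proof.
move=> e0 gE [[p pE] f0]; split; last by move=> x; rewrite gE addr_ge0.
exists (p + mpoly.mpolyC n e) => x.
by rewrite gE mpoly.mevalD mpoly.mevalC pE.
Qed.

Lemma affine_nonneg_comb {R : realType} {n m : nat} {X : set 'cV[R]_n}
    {alpha : 'I_m -> 'cV[R]_n -> R} (u : 'I_m -> R) (e : R) :
  (forall i, affine_nonneg X (alpha i)) -> (forall i, 0 <= u i) -> 0 <= e ->
  affine_nonneg X (fun x => \sum_i u i * alpha i x + e).
Proof.
move=> halpha u0 e0; split=> [|x Xx]; last first.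
  rewrite addr_ge0// sumr_ge0// => i _; rewrite mulr_ge0//.
  by have [_ /(_ x Xx)] := halpha i.
have /choice[p pE] : forall i, exists p : 'rV[R]_n * R,
    forall x, alpha i x = (p.1 *m x) 0 0 + p.2.
  by move=> i; have [[a [d ad]] _] := halpha i; exists (a, d).
exists (\sum_i u i *: (p i).1), (\sum_i u i * (p i).2 + e) => x.
rewrite addrA mulmx_suml summxE -big_split/=; congr (_ + _).
by apply: eq_bigr => i _; rewrite pE mulrDr -scalemxAl [in RHS]mxE.
Qed.

Lemma L_feasible_change_repr (R : realType) (n m m' : nat) (Q : 'M[R]_n)
    (c : 'cV[R]_n) (A : 'M[R]_(m, n)) (b : 'cV[R]_m)
    (A' : 'M[R]_(m', n)) (b' : 'cV[R]_m') (l : R) (alpha : 'I_m -> 'cV[R]_n -> R) :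
  (polyhedron A b !=set0)%classic -> polyhedron A b = polyhedron A' b' ->
  L_feasible Q c A b l alpha -> exists alpha', L_feasible Q c A' b' l alpha'.
Proof.
move=> X0 XE [hpoly halpha]; rewrite XE in X0 halpha.
(* [p i] pairs the multipliers of the [i]-th old inequality with its constant [e_i]. *)
have /choice[p pP] : forall i, exists p : 'rV[R]_m' * R,
    [/\ forall j, 0 <= p.1 0 j, 0 <= p.2 &
        forall x : 'cV_n, (A *m x) i 0 - b i 0 =
          \sum_j p.1 0 j * ((A' *m x) j 0 - b' j 0) - p.2].
  move=> i; have [x|u [e [u0 e0 aE dE]]] :=
    @affine_farkas R _ _ A' b' (- row i A) (b i 0) X0.
    rewrite -XE => /(_ i) Ax.
    by rewrite mulNmx -row_mul mxE [X in - X]mxE addrC subr_ge0.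
  exists (u, e); split=> //= x.
  have -> : (A *m x) i 0 = (u *m (A' *m x)) 0 0.
    by rewrite mulmxA -(oppr_inj aE) -row_mul [RHS]mxE.
  rewrite dE opprD addrA; congr (_ - _).
  by rewrite !mxE -sumrB; apply: eq_bigr => j _; rewrite mulrBr.
have [[a [d adE]] gX] : affine_nonneg (polyhedron A' b')
    (fun x => \sum_i (p i).2 * alpha i x + 0).
  by apply: affine_nonneg_comb => // i; have [] := pP i.
have [x Xx|v [e [v0 e0 aE dE]]] := @affine_farkas R _ _ A' b' a d X0.
  by rewrite -adE; apply: gX.
(* The constants [v 0 j] come from Farkas' lemma for the aggregated function [\sum_i e_i alpha_i];
   they absorb all of it but the constant [e]. *)
exists (fun j x => \sum_i (p i).1 0 j * alpha i x + v 0 j); split; last first.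
  by move=> j; apply: affine_nonneg_comb => // i; have [] := pP i.
(* The polynomial for the new multipliers is the old one plus [e]. *)
apply: (poly_nonnegD_cst e0 _ hpoly) => x; rewrite -[RHS]addrA; congr (_ + _).
have gE : \sum_i (p i).2 * alpha i x =
    e - \sum_j v 0 j * ((A' *m x) j 0 - b' j 0).
  rewrite -[LHS]addr0 adE aE dE mulNmx -mulmxA addrA addrC; congr (_ + _).
  rewrite [(- _ : 'M_1) 0 0]mxE !(mxE, big_distrr) addrC -sumrB -sumrN.
  by apply: eq_bigr => j _; rewrite mxE; ring.
have -> : \sum_i alpha i x * ((A *m x) i 0 - b i 0) =
    \sum_i alpha i x * \sum_j (p i).1 0 j * ((A' *m x) j 0 - b' j 0)
    - \sum_i (p i).2 * alpha i x.
  rewrite -sumrB; apply: eq_bigr => i _.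
  by have [_ _ ->] := pP i; rewrite mulrBr [(p i).2 * _]mulrC.
rewrite gE opprB addrA addrNK.
under eq_bigr do rewrite mulrDl; rewrite big_split /=; congr (_ + _).
under [RHS]eq_bigr do rewrite mulr_sumr; rewrite exchange_big /=.
apply: eq_bigr => j _; rewrite mulr_suml.
by apply: eq_bigr => i _; ring.
Qed.

Theorem theorem3 (R : realType) (n : nat) (Q : 'M[R]_n) (c : 'cV[R]_n)
    (hQ : Q^T = Q) (X : set 'cV[R]_n) (hX : polytope X)
    (mbar mhat : nat)
    (Abar : 'M[R]_(mbar, n)) (bbar : 'cV[R]_mbar)
    (Ahat : 'M[R]_(mhat, n)) (bhat : 'cV[R]_mhat)
    (hbar : X = polyhedron Abar bbar) (hhat : X = polyhedron Ahat bhat) :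
  L_value Q c Abar bbar = L_value Q c Ahat bhat.
Proof.
have [X0 _ _] := hX; rewrite /L_value; congr (ereal_sup (image _ _)).
apply/seteqP; split=> l [alpha]; apply: L_feasible_change_repr.
- by rewrite -hbar.
- by rewrite -hbar.
- by rewrite -hhat.
- by rewrite -hhat.
Qed.
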